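(* Let $X$ and $Y$ be stratified sets, let $X'\subseteq X$ and $Y'\subseteq Y$ be generic subsets of $X$ and $Y$ respectively, and let $f:X'\to Y'$ be a surjective, stratification-preserving, bounded-to-one map. Then for any $P\subseteq X$ such that $f$ respects $P$, the set $P$ is generic in $X$ if and only if $f(P\cap X')$ is generic in $Y$; and $P$ is negligible in $X$ if and only if $f(P\cap X')$ is negligible in $Y$.
   Context: A stratification of a countably infinite set $S$ is an infinite sequence $S_1,S_2,\dots$ of finite subsets of $S$ (not necessarily disjoint) whose union is $S$; a stratified set is a countably infinite set equipped with a stratification. A subset $Z\subseteq S$ is generic if $\lim_{n\to\infty}|Z\cap S_n|/|S_n|=1$, and negligible if $S\setminus Z$ is generic (equivalently, the limit exists and is $0$). With $X_n$, $Y_n$ denoting the stratifications of $X$, $Y$: a map $f:X'\to Y'$ is stratification-preserving if for every $x\in X'$ and every $n\in\mathbb{N}$ we have $x\in X_n$ if and only if $f(x)\in Y_n$. It respects $P\subseteq X$ if $f(P\cap X')$ and $f((X\setminus P)\cap X')$ are disjoint. It is bounded-to-one if there is a finite upper bound on the cardinalities of the fibres $f^{-1}(y)$, $y\in Y'$. *)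

(* Defs.v *)
From HB Require Import structures.
From mathcomp Require Import all_boot all_order all_algebra.
From mathcomp Require Import finmap.
From mathcomp Require Import all_classical all_reals all_analysis.
Import numFieldNormedType.Exports.

Set Implicit Arguments.
Unset Strict Implicit.
Unset Printing Implicit Defensive.

Import Order.TTheory GRing.Theory Num.Theory.

Local Open Scope classical_set_scope.
Local Open Scope card_scope.
Local Open Scope ring_scope.

(* The stratification S_1, S_2, ... is indexed here from 0. *)
Structure stratifiedSet := StratifiedSet {
  carrier :> choiceType;
  stratum : nat -> {fset carrier};
  carrier_countably_infinite : [set: carrier] #= [set: nat];
  bigcup_stratum : \bigcup_n [set` stratum n] = [set: carrier] }.

(* If a stratum is empty, the quotient below is 0 / 0 = 0; hence a set is
   generic only if all but finitely many strata are nonempty. *)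
Definition is_generic (R : realType) (S : stratifiedSet) (Z : set S) : Prop :=
  (#|` [fset x in stratum S n | x \in Z]%fset|%:R / #|` stratum S n|%:R : R)
    @[n --> \oo] --> (1 : R).

Definition is_negligible (R : realType) (S : stratifiedSet) (Z : set S) : Prop :=
  is_generic R (~` Z).

(* A map X' -> Y' between subsets is represented by a function f : X -> Y that
   maps X' into Y'; its values outside X' play no role in what follows. *)
Definition stratification_preserving (X Y : stratifiedSet) (X' : set X)
    (f : X -> Y) : Prop :=
  forall x, X' x -> forall n, x \in stratum X n <-> f x \in stratum Y n.

Definition respects (X Y : Type) (X' : set X) (f : X -> Y) (P : set X) : Prop :=
  f @` (P `&` X') `&` f @` (~` P `&` X') = set0.

Definition bounded_to_one (X Y : Type) (X' : set X) (Y' : set Y)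
    (f : X -> Y) : Prop :=
  exists k : nat, forall y, Y' y -> X' `&` f @^-1` [set y] #<= `I_k.

(* Main.v *)
(** Genericity of [Z] means that the part of the [n]-th stratum outside [Z] is
    eventually smaller than any fixed fraction of that stratum. For [A] contained
    in [X'] the map [f] sends the [n]-th stratum of [A] onto the [n]-th stratum of
    [f A] with fibres of size at most [k], so the two differ in size by a factor
    of at most [k]. Taking [A = X'] shows that the strata of [X] and [Y] have
    comparable sizes; taking [A = X' \ P], whose image is [Y' \ f (P /\ X')]
    because [f] respects [P], compares the two complements. *)

Require Import Defs.
From HB Require Import structures.
From mathcomp Require Import all_boot all_order all_algebra.
From mathcomp Require Import finmap.
From mathcomp Require Import all_classical all_reals all_analysis.
From mathcomp Require Import zify.
Import numFieldNormedType.Exports.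

Set Implicit Arguments.
Unset Strict Implicit.
Unset Printing Implicit Defensive.

Import Order.TTheory GRing.Theory Num.Theory.

Local Open Scope classical_set_scope.
Local Open Scope ring_scope.

Definition stratum_count (S : stratifiedSet) (Z : set S) (n : nat) : nat :=
  #|` [fset x in stratum S n | x \in Z]%fset|.

Lemma stratum_countC (S : stratifiedSet) (Z : set S) n :
  (stratum_count Z n + stratum_count (~` Z) n = #|` stratum S n|)%N.
Proof.
rewrite -(cardfsID [fset x in stratum S n | x \in Z]%fset (stratum S n)).
rewrite /stratum_count; congr addn; do 2 congr (_ _); apply/fsetP => x; rewrite !inE /=.
  by rewrite andbA andbb.
by rewrite in_setC; case: (x \in stratum S n); rewrite ?andbF ?andbT.
Qed.

Lemma stratum_count_le (S : stratifiedSet) (Z : set S) n :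
  (stratum_count Z n <= #|` stratum S n|)%N.
Proof. by rewrite -(stratum_countC Z) leq_addr. Qed.

Lemma stratum_count_mono (S : stratifiedSet) (A B : set S) n :
  A `<=` B -> (stratum_count A n <= stratum_count B n)%N.
Proof.
move=> AB; apply/fsubset_leq_card/fsubsetP => x; rewrite !inE /=.
by move=> /andP[-> /set_mem/AB Bx]; rewrite mem_set.
Qed.

Lemma stratum_count_leqU (S : stratifiedSet) (Z A B : set S) n :
  Z `<=` A `|` B -> (stratum_count Z n <= stratum_count A n + stratum_count B n)%N.
Proof.
move=> ZAB.
apply: leq_trans (leq_card_fsetU [fset x in stratum S n | x \in A]%fset
                                 [fset x in stratum S n | x \in B]%fset).
apply/fsubset_leq_card/fsubsetP => x; rewrite !inE /= => /andP[-> /set_mem Zx].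
by have [Ax|Bx] := ZAB _ Zx; apply/orP; [left|right]; rewrite mem_set.
Qed.

(** A preimage in [A] of a point of the [n]-th stratum lies in the [n]-th stratum itself, so [f]
    maps the stratum of [A] onto that of its image. *)
Lemma stratum_count_image (X Y : stratifiedSet) (X' A : set X) (f : X -> Y) n :
  stratification_preserving X' f -> A `<=` X' ->
  (stratum_count (f @` A) n <= stratum_count A n)%N.
Proof.
move=> f_strat AX'.
apply: (@leq_trans #|` f @` [fset x in stratum X n | x \in A]|%fset);
  last exact: leq_imfset_card.
apply/fsubset_leq_card/fsubsetP => y; rewrite !inE /= => /andP[yn].
move=> /set_mem[x Ax fxy]; rewrite -fxy; apply: in_imfset.
rewrite !inE /= mem_set// andbT; apply/(f_strat x (AX' _ Ax)).
by rewrite fxy.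
Qed.

Lemma leq_stratum_count_image (X Y : stratifiedSet) (X' A : set X)
    (f : X -> Y) k n :
  stratification_preserving X' f -> A `<=` X' ->
  (forall y, (f @` X') y -> (X' `&` f @^-1` [set y] #<= `I_k)%card) ->
  (stratum_count A n <= k * stratum_count (f @` A) n)%N.
Proof.
move=> f_strat AX' f_fib; set An := [fset x in stratum X n | x \in A]%fset.
have subA x : x \in An -> x \in stratum X n /\ A x.
  by rewrite !inE /= => /andP[? /set_mem].
apply: (@leq_trans (k * #|` f @` An|%fset)%N); last first.
  rewrite leq_mul2l; apply/orP; right.
  apply/fsubset_leq_card/fsubsetP => _ /imfsetP[x /= /subA[xn Ax] ->].
  rewrite !inE /= mem_set ?andbT; last by exists x.
  exact/(f_strat x (AX' _ Ax)).
(* Count [An] fibre by fibre: each value of [f] on [An] should contribute at most [k]. *)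
rewrite /stratum_count -/An !card_fset_sum1 (partition_big_imfset _ f).
rewrite big_distrr /= !big_seq; apply: leq_sum => _ /imfsetP[x /= /subA[xn Ax] ->].
rewrite muln1 -big_filter sum1_size.
set s := (X in size X).
have us : uniq s by rewrite filter_uniq// fset_uniq.
have -> : size s = #|` [fset z in s]%fset| by rewrite card_fseq undup_id.
rewrite -card_le_II.
apply: card_le_trans (f_fib (f x) _); last by exists x => //; exact: AX'.
rewrite -(card_le_eql (introT (@card_eq_fsetP _ _ _) erefl)).
apply: subset_card_le => z /=; rewrite !inE mem_filter => /andP[/eqP fz /subA[_ Az]].
by split; [exact: AX'|].
Qed.

(* The strict inequality also records that the stratum is nonempty for large n. *)
Lemma is_genericP (R : realType) (S : stratifiedSet) (Z : set S) :
  is_generic R Z <->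
  forall m, \forall n \near \oo,
    (m * stratum_count (~` Z) n < #|` stratum S n|)%N.
Proof.
have dist n : (0 < #|` stratum S n|)%N ->
    `|1 - (stratum_count Z n)%:R / #|` stratum S n|%:R| =
    (stratum_count (~` Z) n)%:R / #|` stratum S n|%:R :> R.
  move=> s0; rewrite -(stratum_countC Z) in s0 *.
  have s0R : (stratum_count Z n + stratum_count (~` Z) n)%:R != 0 :> R.
    by rewrite pnatr_eq0 -lt0n.
  rewrite -[RHS]ger0_norm ?divr_ge0//; congr `|_|; apply: (mulIf s0R).
  by rewrite mulrBl mul1r !divfK// natrD addrAC subrr add0r.
split => [/cvgrPdist_lt genZ m|genZ].
  have m0 : 0 < m.+1%:R :> R by rewrite ltr0n.
  have im0 : 0 < m.+1%:R^-1 :> R by rewrite invr_gt0.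
  near=> n.
  have : `|1 - (stratum_count Z n)%:R / #|` stratum S n|%:R| < m.+1%:R^-1 :> R.
    by near: n; exact: genZ.
  (* On an empty stratum the quotient is 0, at distance 1 from the limit, which is not below
     [m.+1%:R^-1]. *)
  have [s0|s0] := posnP #|` stratum S n|.
    by rewrite s0 invr0 mulr0 subr0 normr1 ltNge invf_le1// ler1n.
  rewrite dist// ltr_pdivrMr ?ltr0n// mulrC ltr_pdivlMr// -natrM ltr_nat mulnC.
  by apply: leq_ltn_trans; rewrite leq_mul2r leqnSn orbT.
apply/cvgrPdist_lt => e e0.
near=> n.
(* The multiplier is an integer exceeding [e^-1]. *)
have bs : ((Num.truncn e^-1).+1 * stratum_count (~` Z) n < #|` stratum S n|)%N.
  by near: n; exact: genZ.
have s0 : (0 < #|` stratum S n|)%N by exact: leq_ltn_trans bs.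
rewrite -/(stratum_count Z n) dist// ltr_pdivrMr ?ltr0n// mulrC -ltr_pdivrMr//.
rewrite mulrC; apply: le_lt_trans (_ : _ <= (Num.truncn e^-1).+1%:R * (stratum_count (~` Z) n)%:R) _.
  by rewrite ler_wpM2r// ltW// truncnS_gt.
by rewrite -natrM ltr_nat.
Unshelve. all: by end_near. Qed.

Lemma is_generic_transfer (R : realType) (S T : stratifiedSet)
    (S' Z : set S) (T' W : set T) (k : nat) :
  is_generic R S' -> is_generic R T' ->
  (forall n, #|` stratum S n| <= stratum_count (~` S') n + k * #|` stratum T n|)%N ->
  (forall n, stratum_count (~` W) n <=
             stratum_count (~` T') n + k * stratum_count (~` Z) n)%N ->
  is_generic R Z -> is_generic R W.
Proof.
move=> /is_genericP genS' /is_genericP genT' leST leWZ /is_genericP genZ.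
apply/is_genericP => m; near=> n.
have hS : (2 * stratum_count (~` S') n < #|` stratum S n|)%N.
  by near: n; exact: genS'.
have hT : (2 * m * stratum_count (~` T') n < #|` stratum T n|)%N.
  by near: n; exact: genT'.
(* One [k] comes from bounding [~] W[by]~[Z], the other, with a factor 2, from [|S_n| < 2k|T_n|].
   The remaining 2 lets [~] Z[and]~[T'] each use half of the allowance. *)
have hZ : (4 * m * k * k * stratum_count (~` Z) n < #|` stratum S n|)%N.
  by near: n; exact: genZ.
have /= h1 := leST n; have /= h2 := leWZ n.
have : (2 * k * (2 * m * k * stratum_count (~` Z) n) < 2 * k * #|` stratum T n|)%N.
  by lia.
rewrite ltn_mul2l => /andP[_ h3].
have : (m * stratum_count (~` W) n <=
   m * stratum_count (~` T') n + m * k * stratum_count (~` Z) n)%N.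
  by rewrite -mulnA -mulnDr leq_mul2l h2 orbT.
lia.
Unshelve. all: by end_near. Qed.

(** Allows points outside [Y'], which [f] does not reach from [X'], to be discarded. *)
Lemma is_generic_setI (R : realType) (S : stratifiedSet) (T Z : set S) :
  is_generic R T -> is_generic R Z <-> is_generic R (Z `&` T).
Proof.
move=> genT; split; apply: (is_generic_transfer (k := 1) genT genT) => n;
  rewrite mul1n ?leq_addl//; apply: stratum_count_leqU; rewrite ?setCI.
  by rewrite setUC.
by apply: subset_trans (@subsetUr _ _ _); exact: subsetUl.
Qed.

Lemma is_generic_image (R : realType) (X Y : stratifiedSet)
    (X' : set X) (Y' : set Y) (f : X -> Y) (P : set X) :
  is_generic R X' -> is_generic R Y' ->
  set_fun X' Y' f -> set_surj X' Y' f -> stratification_preserving X' f ->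
  bounded_to_one X' Y' f -> respects X' f P ->
  is_generic R P <-> is_generic R (f @` (P `&` X')).
Proof.
move=> genX' genY' f_fun f_surj f_strat [k f_fib] f_respects.
have f_fib' y : (f @` X') y -> (X' `&` f @^-1` [set y] #<= `I_k)%card.
  by move=> [x X'x <-]; apply: f_fib; exact: f_fun.
have BX' : ~` P `&` X' `<=` X' by move=> x [].
split.
  (* The transfer has a single constant; [k.+1] covers both the factor [k] of one inequality and the
     factor 1 of the other. *)
  apply: (is_generic_transfer (k := k.+1) genX' genY') => n.
    rewrite -(stratum_countC X') addnC leq_add2l.
    apply: leq_trans (leq_stratum_count_image n f_strat _ f_fib') _ => //.
    by rewrite leq_mul ?stratum_count_le.
  apply: (@leq_trans (stratum_count (~` Y') n +
                      stratum_count (f @` (~` P `&` X')) n)).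
    apply: stratum_count_leqU => y nAy; have [Y'y|] := pselect (Y' y); last by left.
    have [x X'x fxy] := f_surj _ Y'y; right; exists x => //; split => // Px.
    by apply: nAy; exists x.
  rewrite leq_add2l; apply: leq_trans (stratum_count_image n f_strat BX') _.
  rewrite mulSn (leq_trans _ (leq_addr _ _))//.
  by apply: stratum_count_mono => x [? _].
apply: (is_generic_transfer (k := k.+1) genY' genX') => n.
  rewrite -(stratum_countC Y') addnC leq_add2l mulSn.
  apply: leq_trans (leq_addr _ _); apply: leq_trans (stratum_count_le X' n).
  apply: leq_trans (stratum_count_image n f_strat (@subset_refl _ X')).
  exact: stratum_count_mono f_surj.
apply: (@leq_trans (stratum_count (~` X') n + stratum_count (~` P `&` X') n)).
  apply: stratum_count_leqU => x nPx.
  by have [X'x|] := pselect (X' x); [right|left].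
rewrite leq_add2l.
apply: leq_trans (leq_stratum_count_image n f_strat BX' f_fib') _.
rewrite leq_mul//; apply: stratum_count_mono => y By Ay.
by have : set0 y by rewrite -f_respects.
Qed.

Theorem corollary3 (R : realType) (X Y : stratifiedSet)
    (X' : set X) (Y' : set Y) (f : X -> Y)
    (genX' : is_generic R X') (genY' : is_generic R Y')
    (f_fun : set_fun X' Y' f) (f_surj : set_surj X' Y' f)
    (f_strat : stratification_preserving X' f)
    (f_bounded : bounded_to_one X' Y' f)
    (P : set X) (f_respects : respects X' f P) :
  (is_generic R P <-> is_generic R (f @` (P `&` X'))) /\
  (is_negligible R P <-> is_negligible R (f @` (P `&` X'))).
Proof.
have gen_image Q := is_generic_image genX' genY' f_fun f_surj f_strat f_bounded (P := Q).
split; first exact: gen_image.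
have resp' : respects X' f (~` P) by rewrite /respects setCK setIC.
rewrite /is_negligible gen_image// (is_generic_setI (~` (f @` _)) genY').
(* Surjectivity onto [Y'] gives one inclusion, [f_respects] the other. *)
suff -> : ~` (f @` (P `&` X')) `&` Y' = f @` (~` P `&` X') by [].
apply/seteqP; split => [y [nAy Y'y]|_ [x [nPx X'x] <-]].
  have [x X'x fxy] := f_surj _ Y'y; exists x => //; split => // Px.
  by apply: nAy; exists x.
split; last exact: f_fun.
move=> Afx; have : set0 (f x) by rewrite -f_respects; split => //; exists x.
by [].
Qed.
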